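(* Let $n,k\ge 1$ be integers and let $A\in\mathbb{M}(n)$. For every $X\in\mathbb{M}(n)$, $$\|\otimes^k(A+X)-\otimes^k A\|\le(\|A\|+\|X\|)^k-\|A\|^k.$$
   Context: $\mathbb{M}(n)$ denotes the space of $n\times n$ complex matrices, identified with the linear operators on $\mathcal{H}=\mathbb{C}^n$ (with the Euclidean norm). For a matrix $A\in\mathbb{M}(n)$, $\|A\|=\sup_{\|x\|=1}\|Ax\|$ is the operator norm; the same norm is used on $\mathbb{M}(n^k)$. The $k$-fold tensor power $\otimes^k\mathcal{H}$ is an $n^k$-dimensional Hilbert space with inner product determined by $\langle x_1\otimes\cdots\otimes x_k,y_1\otimes\cdots\otimes y_k\rangle=\prod_{i=1}^k\langle x_i,y_i\rangle$. For an orthonormal basis $e_1,\ldots,e_n$ of $\mathcal{H}$, the basis $\{e_{i_1}\otimes\cdots\otimes e_{i_k}\}$ of $\otimes^k\mathcal{H}$ is ordered lexicographically, and operators on $\otimes^k\mathcal{H}$ are thereby identified with $\mathbb{M}(n^k)$. The tensor power $\otimes^k A\in\mathbb{M}(n^k)$ is the operator determined by $(\otimes^k A)(x_1\otimes\cdots\otimes x_k)=Ax_1\otimes\cdots\otimes Ax_k$. *)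

(* Defs.v *)
From HB Require Import structures.
From mathcomp Require Import all_boot all_order all_algebra.
From mathcomp Require Import complex mxtens.
From mathcomp Require Import boolp classical_sets reals.

Set Implicit Arguments.
Unset Strict Implicit.
Unset Printing Implicit Defensive.

Import Order.TTheory GRing.Theory Num.Theory.
Local Open Scope ring_scope.
Local Open Scope complex_scope.

Definition cdot (R : realType) (m : nat) (x y : 'cV[R[i]]_m) : R[i] :=
  \sum_(i < m) x i 0 * (y i 0)^*%C.

Definition enorm (R : realType) (m : nat) (x : 'cV[R[i]]_m) : R :=
  Num.sqrt (complex.Re (cdot x x)).

(* [sup] is real-valued, so this is the operator norm only for 0 < m: for
   m = 0 there is no unit vector and [sup set0 = 0]. *)
Definition opnorm (R : realType) (m : nat) (A : 'M[R[i]]_m) : R :=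
  sup [set enorm (A *m x) | x in [set x : 'cV[R[i]]_m | enorm x = 1]]%classic.

(* The k-fold tensor power of A is [ntensmx A k], the iterated Kronecker product
   A *t (A *t ...). The index of e_i *t e_j is i * q + j, where q is the dimension
   of the second factor, so the basis of the tensor power is in lexicographic
   order. *)

(* x 0 *t (x 1 *t ... *t x k), a tensor of k.+1 factors *)
Fixpoint puretens (R : realType) (n : nat) (x : nat -> 'cV[R[i]]_n) (k : nat) :
    'cV[R[i]]_(n ^ k.+1) :=
  if k is k'.+1 then x 0 *t puretens (fun i => x i.+1) k' else x 0.

Lemma ntensmx_puretens (R : realType) (n k : nat) (A : 'M[R[i]]_n)
    (x : nat -> 'cV[R[i]]_n) :
  ntensmx A k.+1 *m puretens x k = puretens (fun i => A *m x i) k.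
Proof.
elim: k x => [//|k IHk] x.
rewrite ntensmxSS /= -IHk.
exact: (tensmx_mul A (ntensmx A k.+1) (x 0) (puretens (fun i => x i.+1) k)).
Qed.

Lemma cdot_puretens (R : realType) (n k : nat) (x y : nat -> 'cV[R[i]]_n) :
  cdot (puretens x k) (puretens y k) = \prod_(i < k.+1) cdot (x i) (y i).
Proof.
elim: k x y => [|k IHk] x y; first by rewrite big_ord1.
rewrite big_ord_recl -(IHk (fun i => x i.+1) (fun i => y i.+1)) [RHS]mulr_sum.
apply: eq_bigr => i _; rewrite !mxE rmorphM mulrACA.
by do ![congr (_ * _)]; congr (_ _ _); rewrite ?ord1.
Qed.

(* Main.v *)
Require Import Defs.
From mathcomp Require Import all_boot all_order all_algebra.
From mathcomp Require Import complex mxtens.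
From mathcomp Require Import boolp classical_sets reals.
From mathcomp Require Import ring.

Set Implicit Arguments.
Unset Strict Implicit.
Unset Printing Implicit Defensive.

Import Order.TTheory GRing.Theory Num.Theory.
Local Open Scope ring_scope.
Local Open Scope complex_scope.

(** The tensor powers satisfy the telescoping identity
    [(A + X) *t T' - A *t T = A *t (T' - T) + X *t T'], where [T] and [T'] are
    the [k]-th powers of [A] and [A + X].  With [a] and [x] the norms of [A] and
    [X], submultiplicativity of the norm under [*t] bounds [T'] by
    [(a + x) ^+ k] ([opnorm_ntensmx_le]), so that induction on [k] bounds the
    left-hand side by
    [a * ((a + x) ^+ k - a ^+ k) + x * (a + x) ^+ k
     = (a + x) ^+ k.+1 - a ^+ k.+1].

    Submultiplicativity ([opnorm_tens_le]) comes from the factorization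
    [A *t B = (A *t 1%:M) *m (1%:M *t B)].  A vector of the tensor product is
    a [p] by [q] array; [1%:M *t B] applies [B] to each row and [A *t 1%:M]
    applies [A] to each column, while the squared norm of the array is the sum
    of the squared norms of its rows, and equally of its columns.

    As [opnorm] is a supremum in the reals, it bounds [enorm (A *m x)] only
    once the unit sphere is known to have a bounded image ([opnorm_bounded]). *)

(** * The Euclidean norm *)

Lemma normc_ge0 (R : rcfType) (z : R[i]) : 0 <= Normc.normc z.
Proof. by case: z => a b; apply: sqrtr_ge0. Qed.

Lemma enorm_ge0 (R : realType) (m : nat) (x : 'cV[R[i]]_m) : 0 <= enorm x.
Proof. exact: sqrtr_ge0. Qed.

(** Most norm estimates below are between sums of squares, which avoids the
    square root in [enorm] and its complex-valued argument. *)
Lemma sqr_enorm (R : realType) (m : nat) (x : 'cV[R[i]]_m) :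
  enorm x ^+ 2 = \sum_(i < m) Normc.normc (x i 0) ^+ 2.
Proof.
have E : \sum_(i < m) Normc.normc (x i 0) ^+ 2 = complex.Re (cdot x x).
  rewrite /cdot (big_morph (@complex.Re R) (id1 := 0) (op1 := +%R)) //; last first.
    by move=> [a b] [c d].
  apply: eq_bigr => i _; case: (x i 0) => a b /=.
  by rewrite sqr_sqrtr ?addr_ge0 ?sqr_ge0 // mulrN opprK !expr2.
rewrite E sqr_sqrtr // -E.
by apply: sumr_ge0 => i _; apply: sqr_ge0.
Qed.

Lemma ler_sqr_enorm (R : realType) (m : nat) (x : 'cV[R[i]]_m) (c : R) :
  0 <= c -> (enorm x <= c) = (\sum_(i < m) Normc.normc (x i 0) ^+ 2 <= c ^+ 2).
Proof. by move=> c0; rewrite -sqr_enorm ler_sqr ?nnegrE ?enorm_ge0. Qed.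

Lemma normc_le_enorm (R : realType) (m : nat) (x : 'cV[R[i]]_m) (j : 'I_m) :
  Normc.normc (x j 0) <= enorm x.
Proof.
rewrite -ler_sqr ?nnegrE ?normc_ge0 ?enorm_ge0 // sqr_enorm (bigD1 j) //= lerDl.
by apply: sumr_ge0 => i _; apply: sqr_ge0.
Qed.

Lemma enorm0 (R : realType) (m : nat) : enorm (0 : 'cV[R[i]]_m) = 0.
Proof.
apply/eqP; rewrite -sqrf_eq0 sqr_enorm big1 // => i _.
by rewrite mxE Normc.normc0 expr0n.
Qed.

Lemma enorm_eq0 (R : realType) (m : nat) (x : 'cV[R[i]]_m) :
  enorm x = 0 -> x = 0.
Proof.
move=> x0; apply/colP => i; rewrite mxE; apply: Normc.eq0_normc.
by apply/eqP; rewrite eq_le -{1}x0 normc_le_enorm normc_ge0.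
Qed.

Lemma enormZ (R : realType) (m : nat) (c : R[i]) (x : 'cV[R[i]]_m) :
  enorm (c *: x) = Normc.normc c * enorm x.
Proof.
have c0 := normc_ge0 c.
apply/eqP; rewrite -(@eqrXn2 _ 2) ?enorm_ge0 ?mulr_ge0 ?enorm_ge0 //.
rewrite exprMn !sqr_enorm mulr_sumr; apply/eqP; apply: eq_bigr => i _.
by rewrite mxE Normc.normcM exprMn.
Qed.

(** By convexity of the square: with [a] and [b] the norms of [x] and [y], each
    coordinate obeys
    [(s + t) ^+ 2 <= (1 + b / a) * s ^+ 2 + (1 + a / b) * t ^+ 2], and the sum
    over the coordinates is [(a + b) ^+ 2]. *)
Lemma ler_enormD (R : realType) (m : nat) (x y : 'cV[R[i]]_m) :
  enorm (x + y) <= enorm x + enorm y.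
Proof.
have [/enorm_eq0-> | x0] := eqVneq (enorm x) 0; first by rewrite enorm0 !add0r.
have [/enorm_eq0-> | y0] := eqVneq (enorm y) 0; first by rewrite enorm0 !addr0.
rewrite ler_sqr_enorm ?addr_ge0 ?enorm_ge0 //.
have Ex := sqr_enorm x; have Ey := sqr_enorm y.
have a0 : 0 < enorm x by rewrite lt_def x0 enorm_ge0.
have b0 : 0 < enorm y by rewrite lt_def y0 enorm_ge0.
move: (enorm x) (enorm y) x0 y0 Ex Ey a0 b0 => a b x0 y0 Ex Ey a0 b0.
have -> : (a + b) ^+ 2 = (1 + b / a) * a ^+ 2 + (1 + a / b) * b ^+ 2.
  by field; apply/andP.
rewrite Ex Ey !mulr_sumr -big_split; apply: ler_sum => i _ /=; rewrite mxE.
(* The ascription moves the sum to [R[i]] from the real normed space [Rcomplex R]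
   in which [le_normcD] is stated. *)
have le_r : Normc.normc (x i 0 + y i 0)
    <= Normc.normc (x i 0) + Normc.normc (y i 0) := le_normcD _ _.
move: le_r (normc_ge0 (x i 0 + y i 0)) (normc_ge0 (x i 0)) (normc_ge0 (y i 0)).
move: (Normc.normc (x i 0 + y i 0)) (Normc.normc (x i 0)) (Normc.normc (y i 0)).
move=> r s t le_r r0 s0 t0.
apply: (@le_trans _ _ ((s + t) ^+ 2)).
  by rewrite ler_sqr ?nnegrE ?addr_ge0.
rewrite -subr_ge0.
have -> : (1 + b / a) * s ^+ 2 + (1 + a / b) * t ^+ 2 - (s + t) ^+ 2
    = (b * s - a * t) ^+ 2 / (a * b).
  by field; apply/andP.
by rewrite divr_ge0 ?sqr_ge0 // mulr_ge0 // ltW.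
Qed.

(** * The operator norm *)

Lemma opnorm_ge0 (R : realType) (m : nat) (A : 'M[R[i]]_m) : 0 <= opnorm A.
Proof.
rewrite /opnorm; set S := (X in sup X).
have [supS|noS] := pselect (has_sup S); last by rewrite sup_out.
have [[y [x x1 _]] ubS] := supS.
by apply: le_trans (enorm_ge0 (A *m x)) _; apply: ub_le_sup => //; exists x.
Qed.

Lemma opnorm_le (R : realType) (m : nat) (A : 'M[R[i]]_m) (c : R) :
  0 <= c -> (forall x, enorm (A *m x) <= c * enorm x) -> opnorm A <= c.
Proof.
move=> c0 Ac; rewrite /opnorm; set S := (X in sup X).
(* Without a unit vector the supremum is the default value zero. *)
have [S0|S0] := pselect (S !=set0)%classic; last by rewrite sup_out // => -[].
apply: ge_sup => //.
by move=> _ [x /= x1 <-]; rewrite (le_trans (Ac x)) // x1 mulr1.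
Qed.

(** [A *m x] is the combination of the columns of [A] with coefficients
    [x j 0], each at most [enorm x]; hence the sum of the norms of the columns
    is a bound. *)
Lemma opnorm_bounded (R : realType) (m : nat) (A : 'M[R[i]]_m) :
  exists c : R, forall x, enorm (A *m x) <= c * enorm x.
Proof.
exists (\sum_(j < m) enorm (col j A)) => x.
have -> : A *m x = \sum_(j < m) x j 0 *: col j A.
  apply/colP => i; rewrite mxE summxE; apply: eq_bigr => j _.
  by rewrite !mxE mulrC.
rewrite mulr_suml.
elim/big_rec2: _ => [|j c v _ le_vc]; first by rewrite enorm0.
apply: le_trans (ler_enormD _ _) _; apply: lerD => //.
by rewrite enormZ mulrC ler_wpM2l ?enorm_ge0 ?normc_le_enorm.
Qed.

(** The supremum runs over unit vectors only; homogeneity extends the bound to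
    all [x]. *)
Lemma enorm_mulmx_le (R : realType) (m : nat) (A : 'M[R[i]]_m)
    (x : 'cV[R[i]]_m) : enorm (A *m x) <= opnorm A * enorm x.
Proof.
have [/enorm_eq0-> | x0] := eqVneq (enorm x) 0.
  by rewrite mulmx0 enorm0 mulr0.
have a0 : 0 < enorm x by rewrite lt_def x0 enorm_ge0.
have nV : Normc.normc ((enorm x)^-1)%:C = (enorm x)^-1.
  by rewrite /= expr0n addr0 sqrtr_sqr ger0_norm // invr_ge0 ltW.
rewrite -ler_pdivrMr // mulrC -nV -enormZ scalemxAr.
apply: ub_le_sup.
  have [c Ac] := opnorm_bounded A.
  by exists c => _ [y /= y1 <-]; rewrite (le_trans (Ac y)) // y1 mulr1.
by exists (((enorm x)^-1)%:C *: x) => //=; rewrite enormZ nV mulVf.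
Qed.

Lemma opnormD_le (R : realType) (m : nat) (A B : 'M[R[i]]_m) :
  opnorm (A + B) <= opnorm A + opnorm B.
Proof.
apply: opnorm_le => [|x]; first by rewrite addr_ge0 ?opnorm_ge0.
rewrite mulmxDl mulrDl (le_trans (ler_enormD _ _)) //.
by rewrite lerD ?enorm_mulmx_le.
Qed.

Lemma opnormM_le (R : realType) (m : nat) (A B : 'M[R[i]]_m) :
  opnorm (A *m B) <= opnorm A * opnorm B.
Proof.
apply: opnorm_le => [|x]; first by rewrite mulr_ge0 ?opnorm_ge0.
rewrite -mulmxA -mulrA (le_trans (enorm_mulmx_le _ _)) //.
by rewrite ler_wpM2l ?opnorm_ge0 ?enorm_mulmx_le.
Qed.

(** * Tensor products *)

(** Row [i] and column [j] of a vector of the tensor product, seen as a [p] by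
    [q] array. *)
Definition tens_row (C : Type) (p q : nat) (y : 'cV[C]_(p * q)) (i : 'I_p) :
    'cV[C]_q :=
  \col_j y (mxtens_index (i, j)) 0.

Definition tens_col (C : Type) (p q : nat) (y : 'cV[C]_(p * q)) (j : 'I_q) :
    'cV[C]_p :=
  \col_i y (mxtens_index (i, j)) 0.

Lemma sum_mxtens (V : nmodType) (p q : nat) (F : 'I_(p * q) -> V) :
  \sum_(k < p * q) F k = \sum_(i < p) \sum_(j < q) F (mxtens_index (i, j)).
Proof.
rewrite pair_big (reindex (@mxtens_index p q)) /=.
  by apply: eq_bigr => -[].
exists (@mxtens_unindex p q) => ij _.
  exact: mxtens_indexK.
exact: mxtens_unindexK.
Qed.

Lemma sqr_enorm_tens_row (R : realType) (p q : nat) (y : 'cV[R[i]]_(p * q)) :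
  enorm y ^+ 2 = \sum_(i < p) enorm (tens_row y i) ^+ 2.
Proof.
rewrite sqr_enorm sum_mxtens; apply: eq_bigr => i _.
by rewrite sqr_enorm; apply: eq_bigr => j _; rewrite mxE.
Qed.

Lemma sqr_enorm_tens_col (R : realType) (p q : nat) (y : 'cV[R[i]]_(p * q)) :
  enorm y ^+ 2 = \sum_(j < q) enorm (tens_col y j) ^+ 2.
Proof.
rewrite sqr_enorm sum_mxtens exchange_big; apply: eq_bigr => j _.
by rewrite sqr_enorm; apply: eq_bigr => i _; rewrite mxE.
Qed.

Lemma tens_row_mul1tens (C : comPzRingType) (p q : nat) (B : 'M[C]_q)
    (y : 'cV[C]_(p * q)) (i : 'I_p) :
  tens_row ((1%:M *t B) *m y) i = B *m tens_row y i.
Proof.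
apply/colP => j; rewrite !mxE sum_mxtens (bigD1 i) //= [X in _ + X]big1 ?addr0.
  by apply: eq_bigr => l _; rewrite tensmxE !mxE eqxx mul1r.
move=> k /negPf ki; apply: big1 => l _.
by rewrite tensmxE mxE eq_sym ki !mul0r.
Qed.

Lemma tens_col_multens1 (C : comPzRingType) (p q : nat) (A : 'M[C]_p)
    (y : 'cV[C]_(p * q)) (j : 'I_q) :
  tens_col ((A *t 1%:M) *m y) j = A *m tens_col y j.
Proof.
apply/colP => i; rewrite !mxE sum_mxtens exchange_big (bigD1 j) //=.
rewrite [X in _ + X]big1 ?addr0.
  by apply: eq_bigr => l _; rewrite tensmxE !mxE eqxx mulr1.
move=> k /negPf kj; apply: big1 => l _.
by rewrite tensmxE mxE eq_sym kj mulr0 mul0r.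
Qed.

Lemma opnorm_1tens_le (R : realType) (p q : nat) (B : 'M[R[i]]_q) :
  opnorm ((1%:M : 'M_p) *t B) <= opnorm B.
Proof.
apply: opnorm_le => [|y]; first exact: opnorm_ge0.
have By0 := mulr_ge0 (opnorm_ge0 B) (enorm_ge0 y).
rewrite -ler_sqr ?nnegrE ?enorm_ge0 // exprMn !sqr_enorm_tens_row mulr_sumr.
apply: ler_sum => i _; rewrite tens_row_mul1tens -exprMn ler_sqr ?nnegrE.
- exact: enorm_mulmx_le.
- exact: enorm_ge0.
- by rewrite mulr_ge0 ?opnorm_ge0 ?enorm_ge0.
Qed.

Lemma opnorm_tens1_le (R : realType) (p q : nat) (A : 'M[R[i]]_p) :
  opnorm (A *t (1%:M : 'M_q)) <= opnorm A.
Proof.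
apply: opnorm_le => [|y]; first exact: opnorm_ge0.
have Ay0 := mulr_ge0 (opnorm_ge0 A) (enorm_ge0 y).
rewrite -ler_sqr ?nnegrE ?enorm_ge0 // exprMn !sqr_enorm_tens_col mulr_sumr.
apply: ler_sum => j _; rewrite tens_col_multens1 -exprMn ler_sqr ?nnegrE.
- exact: enorm_mulmx_le.
- exact: enorm_ge0.
- by rewrite mulr_ge0 ?opnorm_ge0 ?enorm_ge0.
Qed.

Lemma opnorm_tens_le (R : realType) (p q : nat) (A : 'M[R[i]]_p)
    (B : 'M[R[i]]_q) :
  opnorm (A *t B) <= opnorm A * opnorm B.
Proof.
rewrite tensmx_decr (le_trans (opnormM_le _ _)) //.
exact: (ler_pM (opnorm_ge0 _) (opnorm_ge0 _)
  (opnorm_tens1_le _ _) (opnorm_1tens_le _ _)).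
Qed.

(** * Tensor powers *)

(** The exponent starts at one because [ntensmx A k.+1] is
    [A *t ntensmx A k] up to conversion for positive [k] only. *)
Lemma opnorm_ntensmx_le (R : realType) (n k : nat) (A : 'M[R[i]]_n) :
  opnorm (ntensmx A k.+1) <= opnorm A ^+ k.+1.
Proof.
elim: k => [|k IHk]; first by rewrite expr1.
rewrite exprS ntensmxSS; apply: le_trans (opnorm_tens_le A (ntensmx A k.+1)) _.
by rewrite ler_wpM2l ?opnorm_ge0.
Qed.

Lemma tensmx_telescope (C : comPzRingType) (m n p q : nat) (A X : 'M[C]_(m, n))
    (T T' : 'M[C]_(p, q)) :
  (A + X) *t T' - A *t T = A *t (T' - T) + X *t T'.
Proof. by apply/matrixP => i j; rewrite !mxE; ring. Qed.

Theorem corollary4p3 (R : realType) (n k : nat) (hn : (0 < n)%N) (hk : (0 < k)%N)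
    (A X : 'M[R[i]]_n) :
  opnorm (ntensmx (A + X) k - ntensmx A k)
    <= (opnorm A + opnorm X) ^+ k - opnorm A ^+ k.
Proof.
case: k hk => // k _; elim: k => [|k IHk].
  by rewrite !ntensmx1 !expr1 [A + X]addrC addrK [_ + opnorm X]addrC addrK.
have leT : opnorm (ntensmx (A + X) k.+1) <= (opnorm A + opnorm X) ^+ k.+1.
  apply: le_trans (opnorm_ntensmx_le k _) _.
  by rewrite lerXn2r ?nnegrE ?addr_ge0 ?opnorm_ge0 ?opnormD_le.
rewrite !ntensmxSS.
rewrite (tensmx_telescope A X (ntensmx A k.+1) (ntensmx (A + X) k.+1)).
rewrite (le_trans (opnormD_le _ _)) //.
have split_pow (a x : R) : (a + x) ^+ k.+2 - a ^+ k.+2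
    = a * ((a + x) ^+ k.+1 - a ^+ k.+1) + x * (a + x) ^+ k.+1.
  by rewrite !(exprS _ k.+1) mulrDl mulrBr addrAC.
rewrite split_pow.
apply: lerD.
  apply: le_trans (opnorm_tens_le A _) _.
  by rewrite ler_wpM2l ?opnorm_ge0.
apply: le_trans (opnorm_tens_le X (ntensmx (A + X) k.+1)) _.
by rewrite ler_wpM2l ?opnorm_ge0.
Qed.
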